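(* Let $n,m$ be positive integers with $mn$ even, let $a,b,c,x,y,z$ be positive real numbers, and let $S_{\omega}^{T}(n,m)$ be the weighted silicate network with toroidal boundary condition and edge weights $a,b,c,x,y,z$. Then the sum of weights of the dimer coverings (perfect matchings) of $S_{\omega}^{T}(n,m)$ is $$p(S_{\omega}^{T}(n,m))=2^{mn+1}(xyz)^{\frac{mn}{2}}(ax+by+cz)^{\frac{mn}{2}}.$$
   Context: A perfect matching (dimer covering) of a graph is a set of edges such that every vertex is incident with exactly one edge of the set. In an edge-weighted graph $H$ with positive real weights, the weight of a perfect matching is the product of the weights of its edges, and $p(H)$ denotes the sum of the weights of all perfect matchings of $H$. Hexagonal lattice on the torus: $H^{T}(n,m)$ is the cubic graph with $2mn$ vertices $W_{i,j}, B_{i,j}$ ($i\in\mathbb Z/m$, $j\in\mathbb Z/n$) and $3mn$ edges, in three directions: for each $(i,j)$ there is one edge joining $W_{i,j}$ and $B_{i-1,j}$ (vertical), one edge joining $W_{i,j}$ and $B_{i,j}$ and one edge joining $W_{i,j}$ and $B_{i,j-1}$ (these two families being the two oblique directions, one called slash and the other backslash). Thus each vertex is incident with exactly one vertical, one slash and one backslash edge. (If $m=1$ or $n=1$ some of these edges are parallel; they are kept as distinct edges.) Silicate network: $S^{T}(n,m)$ is the vertex-edge graph (middle graph) of $H^{T}(n,m)$, i.e. its vertex set is $V(H^{T}(n,m))\cup E(H^{T}(n,m))$ (so $5mn$ vertices), and its edge set is the union of $2mn$ edge-disjoint copies of $K_4$, one for each vertex $v$ of $H^{T}(n,m)$, the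 copy for $v$ being the complete graph on $v$ and the three edges of $H^{T}(n,m)$ incident with $v$. Weights: $S_{\omega}^{T}(n,m)$ is $S^{T}(n,m)$ with the following edge weights (edges in the same one of six directions get the same weight). For each vertex $v$ of $H^{T}(n,m)$, let $e_1,e_2,e_3$ be the vertical, slash and backslash edges of $H^{T}(n,m)$ incident with $v$, respectively. In the copy of $K_4$ on $\{v,e_1,e_2,e_3\}$, the edges $ve_1, ve_2, ve_3$ have weights $x,y,z$ respectively, and the edges $e_2e_3, e_1e_3, e_1e_2$ have weights $a,b,c$ respectively; so the edges of weights $a$ and $x$ are disjoint, as are those of weights $b$ and $y$, and those of weights $c$ and $z$. *)

(* Defs.v *)
From HB Require Import structures.
From mathcomp Require Import all_boot all_order all_algebra.
From mathcomp Require Import reals.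
Set Implicit Arguments.
Unset Strict Implicit.
Unset Printing Implicit Defensive.
Import Order.TTheory GRing.Theory Num.Theory.

(* Finite loopless multigraphs: distinct edges may have the same end points. *)
Record mgraph := MGraph {
  vert : finType;
  edge : finType;
  ends : edge -> {set vert};
  ends_card : forall e, #|ends e| = 2 }.

Definition perfect_matching (G : mgraph) (M : {set edge G}) : bool :=
  [forall v : vert G, #|[set e in M | v \in ends e]| == 1].

Definition dimer_sum (R : realType) (G : mgraph) (w : edge G -> R) : R :=
  (\sum_(M : {set edge G} | perfect_matching M) \prod_(e in M) w e)%R.

Section VertexEdgeGraph.
Variable G : mgraph.

Definition star (v : vert G) : {set vert G + edge G} :=
  inl v |: [set inr e | e : edge G & v \in ends e].

(* The edge (v, A) is the edge A of the complete graph on [star v]. Keeping v  *)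
(* makes the complete graphs edge-disjoint even where their vertex sets share *)
(* two elements, which happens when G has parallel edges.                     *)
Definition veg_edge : finType :=
  {q : vert G * {set vert G + edge G} | (#|q.2| == 2) && (q.2 \subset star q.1)}.

Definition veg_ends (q : veg_edge) : {set vert G + edge G} := (val q).2.

Lemma veg_ends_card (q : veg_edge) : #|veg_ends q| = 2.
Proof. by case/andP: (valP q) => /eqP. Qed.

Definition vertex_edge_graph : mgraph := MGraph veg_ends_card.

End VertexEdgeGraph.

Inductive direction := Vertical | Slash | Backslash.

Definition direction_ord (d : direction) : 'I_3 :=
  match d with
  | Vertical => inord 0 | Slash => inord 1 | Backslash => inord 2
  end.

Definition ord_direction (i : 'I_3) : direction :=
  match val i with 0 => Vertical | 1 => Slash | _ => Backslash end.

Lemma direction_ordK : cancel direction_ord ord_direction.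
Proof. by case; rewrite /ord_direction /= inordK. Qed.

HB.instance Definition _ := Finite.copy direction (can_type direction_ordK).

Section Silicate.
Variables n m : nat.

(* Z/m and Z/n are 'I_m and 'I_n, and [ord_pred] is the cyclic predecessor.   *)
(* W_{i,j} is inl (i, j) and B_{i,j} is inr (i, j).                           *)
Definition hex_vert : finType := ('I_m * 'I_n + 'I_m * 'I_n)%type.

(* (i, j, d) is the edge of direction d at W_{i,j}. *)
Definition hex_edge : finType := ('I_m * 'I_n * direction)%type.

Definition hex_dir (e : hex_edge) : direction := e.2.

Definition hex_ends (e : hex_edge) : {set hex_vert} :=
  let: (i, j, d) := e in
  [set inl (i, j);
       inr match d with
           | Vertical => (ord_pred i, j)
           | Slash => (i, j)
           | Backslash => (i, ord_pred j)
           end].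

Lemma hex_ends_card (e : hex_edge) : #|hex_ends e| = 2.
Proof. by case: e => [[i j] d]; rewrite cards2. Qed.

Definition hexagonal_torus : mgraph := MGraph hex_ends_card.

Definition silicate_torus : mgraph := vertex_edge_graph hexagonal_torus.

Definition meets_dir (A : {set vert silicate_torus}) (d : direction) : bool :=
  [exists e : hex_edge, (inr e \in A) && (hex_dir e == d)].

(* If A contains v then A = {v, e_i}, weighted by the direction of e_i;       *)
(* otherwise A = {e_i, e_j}, weighted by the direction missing from A.        *)
Definition silicate_weight (R : realType) (a b c x y z : R)
    (q : edge silicate_torus) : R :=
  let: (v, A) := val q in
  if inl v \in A then
    if meets_dir A Vertical then x else if meets_dir A Slash then y else z
  else
    if ~~ meets_dir A Vertical then a
    else if ~~ meets_dir A Slash then b else c.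

End Silicate.

(* Main.v *)
Require Import Defs.
From HB Require Import structures.
From mathcomp Require Import all_boot all_order all_algebra.
From mathcomp Require Import reals ring zify.
Set Implicit Arguments.
Unset Strict Implicit.
Unset Printing Implicit Defensive.
Import Order.TTheory GRing.Theory Num.Theory.
Local Open Scope ring_scope.

(* Each vertex v of the hexagonal torus is matched inside its own copy of K_4, to *)
(* one of its three edges; the other two edges at v are then matched in that copy *)
(* to each other or not at all. Hence every vertex receives an odd number of its  *)
(* edges, and every edge is received by exactly one of its ends. A vertex         *)
(* receiving only its edge of direction d contributes the weight x, y or z of d,  *)
(* one receiving three edges contributes ax + by + cz. Counting received edges,   *)
(* in total and in each direction, gives mn/2 vertices of the second kind and     *)
(* mn/2 of the first kind for each d, so all distributions of the edges have the  *)
(* same weight. Their number 2^(mn+1) is that of the solutions of a linear system *)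
(* over F_2, computed by a character sum in which, by connectedness, only the two *)
(* constant characters survive.                                                   *)

(** Recording for each edge of the hexagonal torus which end's copy of K_4 matches it makes the
    problem local: [dimer_sum_local] turns the dimer sum into a sum over sets O of edges (those
    given to their W end) of products over vertices, evaluated by [local_sumE]. A product vanishes
    unless every vertex receives 1 or 3 edges. Then 3mn edges over 2mn vertices force mn/2 vertices
    to receive three ([card_full_in_dirs]), and the mn edges of each direction leave mn/2 vertices
    receiving that direction alone, so the product does not depend on O ([prod_local_sum]). By
    [card_parity_sets] and [even_sets_trivial], the 2mn parity conditions on 3mn edges have a single
    nontrivial linear relation, consistent as mn is even; this gives [card_all_odd]. *)

Section ParityCount.

(** * Counting edge sets with prescribed parities at the vertices *)

Variables (R : comNzRingType) (V E : finType) (inc : V -> {set E}).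

Lemma sum_subsets_prod (I : finType) (c : I -> R) :
  \sum_(S : {set I}) \prod_(i in S) c i = \prod_i (1 + c i).
Proof.
under [RHS]eq_bigr do rewrite addrC.
by rewrite bigA_distr; apply: eq_bigr => S _; rewrite -big_mkcond.
Qed.

Lemma prod_setI_sign (O : {set E}) (v : V) :
  (-1) ^+ odd #|O :&: inc v| = \prod_(e in O) (-1) ^+ (e \in inc v) :> R.
Proof.
rewrite signr_odd -sum1_card prodrXr; congr (_ ^+ _).
by rewrite big_mkcond [RHS]big_mkcond; apply: eq_bigr => e _; rewrite !inE; do 2!case: (_ \in _).
Qed.

Lemma prod_sign_card (S : {set V}) (P : pred V) :
  \prod_(v in S) (-1) ^+ P v = (-1) ^+ odd #|[set v in S | P v]| :> R.
Proof.
rewrite signr_odd prodrXr; congr (_ ^+ _).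
rewrite -sum1_card big_mkcond [RHS]big_mkcond; apply: eq_bigr => v _.
by rewrite !inE; case: (v \in S); case: (P v).
Qed.

(* Expand the product over v of the indicators (1 + (-1)^{|O :&: inc v| + t v}) / 2
   over the sets S of vertices, and sum over O first. *)
Lemma card_parity_sets (t : pred V) :
  2 ^+ #|V| * #|[set O : {set E} | [forall v, odd #|O :&: inc v| == t v]]|%:R
  = \sum_(S : {set V} | [forall e, ~~ odd #|[set v in S | e \in inc v]|])
      (-1) ^+ #|[set v in S | t v]| * 2 ^+ #|E| :> R.
Proof.
have -> : 2 ^+ #|V| * #|[set O : {set E} | [forall v, odd #|O :&: inc v| == t v]]|%:R
  = \sum_(O : {set E}) \prod_v (1 + (-1) ^+ t v * (-1) ^+ odd #|O :&: inc v| : R).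
  rewrite -sum1_card natr_sum mulr_sumr.
  rewrite [LHS]big_mkcond; apply: eq_bigr => O _; rewrite inE.
  have [/forallP ok|] := ifPn.
    rewrite mulr1 -prodr_const; apply: eq_bigr => v _.
    by rewrite (eqP (ok v)); case: (t v); rewrite ?expr1 ?mulrNN ?expr0 mulr1.
  rewrite negb_forall => /existsP[v nv]; rewrite (bigD1 v) //=.
  by move: nv; case: (odd _); case: (t v) => // _;
    rewrite ?expr1 ?expr0 ?mulr1 ?mul1r subrr mul0r.
have distr (O : {set E}) : \prod_v (1 + (-1) ^+ t v * (-1) ^+ odd #|O :&: inc v|)
    = \sum_(S : {set V}) (-1) ^+ #|[set v in S | t v]|
        * \prod_(e in O) (-1) ^+ odd #|[set v in S | e \in inc v]| :> R.
  rewrite -sum_subsets_prod; apply: eq_bigr => S _.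
  rewrite big_split prod_sign_card signr_odd /=; congr (_ * _).
  under eq_bigr do rewrite prod_setI_sign.
  by rewrite exchange_big; apply: eq_bigr => e _; rewrite /= prod_sign_card.
under eq_bigr do rewrite distr.
rewrite exchange_big /= [RHS]big_mkcond; apply: eq_bigr => S _.
(* Summing over O leaves one factor per e: 2 if e is incident with an even number of vertices of S,
   and 1 - 1 = 0 otherwise. *)
rewrite -mulr_sumr sum_subsets_prod; case: ifPn => [/forallP ev|].
  congr (_ * _); rewrite -[in RHS]prodr_const; apply: eq_bigr => e _.
  by rewrite (negPf (ev e)).
rewrite negb_forall => /existsP[e]; rewrite negbK => oe.
by rewrite (bigD1 e) //= oe subrr mul0r mulr0.
Qed.

End ParityCount.

(** * Matchings inside one copy of K_4 *)

Lemma direction_eqE (d d' : direction) :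
  (d == d') = match d, d' with
              | Vertical, Vertical | Slash, Slash | Backslash, Backslash => true
              | _, _ => false end.
Proof. by apply/eqP/idP; case: d; case: d'. Qed.

Lemma big_direction (T : Type) (idx : T) (op : Monoid.com_law idx) (F : direction -> T) :
  \big[op/idx]_d F d = op (F Vertical) (op (F Slash) (F Backslash)).
Proof.
rewrite (bigD1 Vertical) //= (bigD1 Slash) ?direction_eqE //=.
rewrite (bigD1 Backslash) ?direction_eqE //= big1 ?Monoid.mulm1 //.
by case; rewrite !direction_eqE.
Qed.

Lemma forall_directionE (P : pred direction) :
  [forall d, P d] = [&& P Vertical, P Slash & P Backslash].
Proof. by apply/forallP/and3P => [H|[? ? ?] []]. Qed.

(* A local edge (d, false) is the edge joining a vertex v to its edge of        *)
(* direction d; (d, true) joins the two edges at v of directions other than d.  *)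
Notation ledge := (direction * bool)%type.

Definition spokes (K : {set ledge}) : nat := #|[set t in K | ~~ t.2]|.
(** The exclusive or says that a local edge meets the edge of direction d at v: a spoke meets only
    its own direction, an opposite edge the two others. *)
Definition cover_dir (K : {set ledge}) (d : direction) : nat :=
  #|[set t in K | (t.1 == d) (+) t.2]|.

Definition local_sum (R : comNzRingType) (w : ledge -> R) (D : pred direction) : R :=
  \sum_(K | (spokes K == 1%N) && [forall d, cover_dir K d == D d :> nat])
     \prod_(t in K) w t.

(** Coding sets of local edges by six booleans lets a sum over them be expanded explicitly. *)
Definition ledge_set (k : bool * bool * bool * bool * bool * bool) : {set ledge} :=
  let: (p, q, r, p', q', r') := k in
  [set t | match t.1 with
           | Vertical => if t.2 then p' else p
           | Slash => if t.2 then q' else q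
           | Backslash => if t.2 then r' else r
           end].

Lemma ledge_set_bij : bijective ledge_set.
Proof.
exists (fun K : {set ledge} =>
  ((Vertical, false) \in K, (Slash, false) \in K, (Backslash, false) \in K,
   (Vertical, true) \in K, (Slash, true) \in K, (Backslash, true) \in K)).
  by case=> [[[[[p q] r] p'] q'] r']; rewrite /ledge_set !inE.
by move=> K; apply/setP => -[[] []]; rewrite inE.
Qed.

Lemma big_ledge (T : Type) (idx : T) (op : Monoid.com_law idx) (F : ledge -> T) :
  \big[op/idx]_t F t =
  op (op (F (Vertical, true)) (F (Vertical, false)))
     (op (op (F (Slash, true)) (F (Slash, false)))
         (op (F (Backslash, true)) (F (Backslash, false)))).
Proof.
transitivity (\big[op/idx]_d \big[op/idx]_b F (d, b)).
  by rewrite pair_bigA; apply: eq_bigr => -[].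
by rewrite big_direction !big_bool.
Qed.

(** One spoke covers one edge at v, and an opposite edge covers two more or is absent. With three
    directions in D, the spoke may be any d and is joined by its opposite edge; with one, it is that
    spoke alone. The truncated exponents keep the second product only in the latter case. *)
Lemma local_sumE (R : comNzRingType) (w : ledge -> R) (D : pred direction) :
  local_sum w D =
  if odd (\sum_d D d) then
    (\sum_d w (d, true) * w (d, false)) ^+ [forall d, D d]
    * \prod_d w (d, false) ^+ (D d - [forall d, D d])
  else 0.
Proof.
pose term (p q r p' q' r' : bool) :=
  if [&& (p + (q + r) == 1)%N, (p + (q' + r') == D Vertical :> nat)%N,
         (p' + (q + r') == D Slash :> nat)%N & (p' + (q' + r) == D Backslash :> nat)%N]
  then w (Vertical, true) ^+ p' * w (Vertical, false) ^+ p
     * (w (Slash, true) ^+ q' * w (Slash, false) ^+ q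
     * (w (Backslash, true) ^+ r' * w (Backslash, false) ^+ r)) else 0.
have -> : local_sum w D = \sum_p \sum_q \sum_r \sum_p' \sum_q' \sum_r' term p q r p' q' r'.
  rewrite !pair_bigA /= /local_sum (reindex ledge_set); last exact/onW_bij/ledge_set_bij.
  rewrite big_mkcond; apply: eq_bigr => -[[[[[p q] r] p'] q'] r'] _ /=.
  rewrite forall_directionE /spokes /cover_dir -!sum1_card !(big_mkcond (fun t => t \in _)).
  rewrite !big_ledge /= !inE !direction_eqE /= /term.
  have expE (u : R) (i : bool) : u ^+ i = if i then u else 1 by case: i.
  by rewrite !andbT !andbF /= !add0n !addn0 !expE.
rewrite forall_directionE !big_direction !big_bool /term /=.
by case: (D Vertical); case: (D Slash); case: (D Backslash); rewrite /=; ring.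
Qed.

(** * Incidence in the hexagonal torus *)

Section Silicate.

Variables n m : nat.
Notation V := (hex_vert n m).
Notation E := (hex_edge n m).
Notation P := ('I_m * 'I_n)%type.

(* The edge of direction d at B_p is (black_shift d p, d). *)
Definition black_shift (d : direction) (p : P) : P :=
  match d with
  | Vertical => (ordS p.1, p.2)
  | Slash => p
  | Backslash => (p.1, ordS p.2)
  end.

Definition black_unshift (d : direction) (p : P) : P :=
  match d with
  | Vertical => (ord_pred p.1, p.2)
  | Slash => p
  | Backslash => (p.1, ord_pred p.2)
  end.

Lemma black_shiftK d : cancel (black_shift d) (black_unshift d).
Proof. by case: d => -[i j] //=; rewrite ordSK. Qed.

Lemma black_unshiftK d : cancel (black_unshift d) (black_shift d).
Proof. by case: d => -[i j] //=; rewrite ord_predK. Qed.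

Definition inc_edge (v : V) (d : direction) : E :=
  match v with inl p => (p, d) | inr p => (black_shift d p, d) end.

Lemma inc_edge_dir v d : (inc_edge v d).2 = d.
Proof. by case: v. Qed.

Lemma inc_edge_inj v : injective (inc_edge v).
Proof. by move=> d d' /(congr1 snd); rewrite !inc_edge_dir. Qed.

Lemma hex_endsE (e : E) : hex_ends e = [set inl e.1; inr (black_unshift e.2 e.1)].
Proof. by case: e => -[i j] []. Qed.

Lemma mem_hex_ends (v : V) (e : E) : (v \in hex_ends e) = (e == inc_edge v e.2).
Proof.
rewrite hex_endsE !inE; case: v e => [p|p] [q d] /=.
  by rewrite orbF xpair_eqE eqxx andbT eq_sym.
by rewrite xpair_eqE eqxx andbT -(can2_eq (black_unshiftK d) (black_shiftK d)) eq_sym.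
Qed.

(** * Edges of the silicate network as pairs of a vertex and a local edge *)

Notation SV := (V + E)%type.

Definition k4_ends (v : V) (t : ledge) : {set SV} :=
  if t.2 then [set inr (inc_edge v d) | d in [set~ t.1]]
  else [set inl v; inr (inc_edge v t.1)].

Lemma inl_k4_ends u v t : (inl u \in k4_ends v t) = (u == v) && ~~ t.2.
Proof.
rewrite /k4_ends; case: t.2; last by rewrite !inE orbF andbT.
by rewrite andbF; apply/negP => /imsetP[].
Qed.

Lemma inr_k4_ends e v t :
  (inr e \in k4_ends v t) = (v \in hex_ends e) && ((t.1 == e.2) (+) t.2).
Proof.
rewrite mem_hex_ends /k4_ends; case: t => d [] /=; last first.
  rewrite !inE addbF /=; change (inr e == inr _) with (e == inc_edge v d).
  apply/eqP/andP => [->|[/eqP {2}-> /eqP ->] //].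
  by rewrite inc_edge_dir !eqxx.
rewrite addbT; apply/imsetP/andP => [[d']|[/eqP ee ne]].
  by rewrite !inE => dd [->]; rewrite inc_edge_dir eqxx eq_sym.
by exists e.2; rewrite ?inE 1?eq_sym // -ee.
Qed.

Lemma k4_ends_ok v t :
  (#|k4_ends v t| == 2%N) && (k4_ends v t \subset @star (hexagonal_torus n m) v).
Proof.
apply/andP; split.
  rewrite /k4_ends; case: t.2; last by rewrite cards2.
  rewrite card_imset; last by move=> d d' [] /inc_edge_inj.
  by rewrite cardsC1 -sum1_card big_mkcond big_direction.
apply/subsetP => -[u|e]; rewrite ?inl_k4_ends ?inr_k4_ends => /andP[].
  by move=> /eqP-> _; rewrite setU11.
by move=> ve _; apply/setU1P; right; apply/imsetP; exists e; rewrite ?inE.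
Qed.

Definition k4_edge (x : V * ledge) : edge (silicate_torus n m) :=
  exist _ (x.1, k4_ends x.1 x.2) (k4_ends_ok x.1 x.2).

Lemma k4_edge_inj : injective k4_edge.
Proof.
move=> [v [d b]] [v' [d' b']] /(congr1 val) /= [<- /setP A].
have := A (inl v); rewrite !inl_k4_ends eqxx /= => bb.
have := A (inr (inc_edge v d)).
rewrite !inr_k4_ends mem_hex_ends inc_edge_dir !eqxx /=.
by move: bb {A}; case: b; case: b' => //= _; case: eqP => // ->.
Qed.

Lemma k4_edge_surj q : exists x, q = k4_edge x.
Proof.
case: q => -[v A] /= okA; have /andP[/= cA sA] := okA.
suff [t tA] : exists t, A = k4_ends v t by exists (v, t); apply: val_inj; rewrite /= tA.
have starP u : u \in A -> u = inl v \/ exists d, u = inr (inc_edge v d).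
  move=> /(subsetP sA); rewrite !inE => /orP[/eqP|/imsetP[e]]; first by left.
  by rewrite inE /= mem_hex_ends => /eqP-> ->; right; exists e.2.
move: cA => /cards2P[u [u' [uu AE]]].
have uA : u \in A by rewrite AE !inE eqxx.
have u'A : u' \in A by rewrite AE !inE eqxx orbT.
have [uE|[d uE]] := starP _ uA; have [u'E|[d' u'E]] := starP _ u'A.
- by rewrite uE u'E eqxx in uu.
- by exists (d', false); rewrite AE uE u'E.
- by exists (d, false); rewrite AE uE u'E setUC.
have dd : d != d' by apply: contraNneq uu; rewrite uE u'E => ->.
have [d0 d0E] : exists d0, [set~ d0] = [set d; d'].
  (* The third direction; the default branch serves the pair [Vertical], [Backslash], equal
     directions being excluded by [dd]. *)
  exists (match d, d' with
    | Vertical, Slash | Slash, Vertical => Backslash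
    | Slash, Backslash | Backslash, Slash => Vertical
    | _, _ => Slash end).
  by apply/setP => d1; rewrite !inE; case: d dd {uE}; case: d' {u'E};
    case: d1; rewrite !direction_eqE.
by exists (d0, true); rewrite /k4_ends /= d0E imsetU !imset_set1 AE uE u'E.
Qed.

Lemma k4_edge_bij : bijective k4_edge.
Proof.
apply: (inj_card_bij k4_edge_inj); rewrite -(card_codom k4_edge_inj).
by apply: subset_leq_card; apply/subsetP => q _; have [x ->] := k4_edge_surj q; apply: codom_f.
Qed.

Definition ledge_weight (R : Type) (a b c x y z : R) (t : ledge) : R :=
  match t.1 with
  | Vertical => if t.2 then a else x
  | Slash => if t.2 then b else y
  | Backslash => if t.2 then c else z
  end.

Lemma silicate_weight_k4 (R : realType) (a b c x y z : R) u :
  silicate_weight a b c x y z (k4_edge u) = ledge_weight a b c x y z u.2.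
Proof.
case: u => v t; rewrite /silicate_weight /= inl_k4_ends eqxx /=.
have meetsE d : meets_dir (k4_ends v t) d = (t.1 == d) (+) t.2.
  rewrite /meets_dir; apply/existsP/idP => [[e]|td].
    by rewrite inr_k4_ends => /andP[/andP[_ h] /eqP<-].
  by exists (inc_edge v d); rewrite inr_k4_ends mem_hex_ends /hex_dir inc_edge_dir !eqxx td.
by rewrite !meetsE; case: t {meetsE} => -[] []; rewrite /ledge_weight /= !direction_eqE.
Qed.

(** * Perfect matchings as families of local configurations *)

Definition k4_family (g : {ffun V -> {set ledge}}) : {set edge (silicate_torus n m)} :=
  [set k4_edge x | x in [pred x | x.2 \in g x.1]].

Lemma k4_family_bij : bijective k4_family.
Proof.
pose fam (M : {set edge (silicate_torus n m)}) : {ffun V -> {set ledge}} :=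
  [ffun v => [set t | k4_edge (v, t) \in M]].
exists fam => [g|M].
  by apply/ffunP => v; apply/setP => t; rewrite ffunE inE mem_imset //; apply: k4_edge_inj.
apply/setP => q; have [[v t] ->] := k4_edge_surj q.
by rewrite mem_imset ?inE /= ?ffunE ?inE //; apply: k4_edge_inj.
Qed.

Lemma card_k4_family (g : {ffun V -> {set ledge}}) (u : SV) :
  #|[set q in k4_family g | u \in @ends (silicate_torus n m) q]|
  = (\sum_v #|[set t in g v | u \in k4_ends v t]|)%N.
Proof.
have -> : [set q in k4_family g | u \in @ends (silicate_torus n m) q]
  = k4_edge @: [set x | (x.2 \in g x.1) && (u \in k4_ends x.1 x.2)].
  apply/setP => q; have [x ->] := k4_edge_surj q.
  by rewrite inE !mem_imset ?inE //; apply: k4_edge_inj.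
rewrite card_imset; last exact: k4_edge_inj.
rewrite -sum1dep_card.
rewrite -(pair_big_dep xpredT (fun v t => (t \in g v) && (u \in k4_ends v t)) (fun _ _ => 1%N)).
by apply: eq_bigr => v _; rewrite sum1dep_card.
Qed.

Definition black_end (e : E) : V := inr (black_unshift e.2 e.1).

(** A vertex v of the hexagonal torus lies only in its own copy of K_4, an edge only in the copies
    of its two ends. *)
Lemma perfect_matching_k4_family (g : {ffun V -> {set ledge}}) :
  perfect_matching (G := silicate_torus n m) (k4_family g) =
  [forall v, spokes (g v) == 1%N] &&
  [forall e : E, (cover_dir (g (inl e.1)) e.2 + cover_dir (g (black_end e)) e.2 == 1)%N].
Proof.
have inlE v : #|[set q in k4_family g | inl v \in @ends (silicate_torus n m) q]| = spokes (g v).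
  rewrite card_k4_family (bigD1 v) //= big1 ?addn0 => [|v' v'v].
    by apply: eq_card => t; rewrite !inE inl_k4_ends eqxx.
  by apply/eqP; rewrite cards_eq0; apply/eqP/setP => t;
    rewrite !inE inl_k4_ends eq_sym (negPf v'v) andbF.
have inrE (e : E) : #|[set q in k4_family g | inr e \in @ends (silicate_torus n m) q]|
    = (cover_dir (g (inl e.1)) e.2 + cover_dir (g (black_end e)) e.2)%N.
  rewrite card_k4_family.
  transitivity (\sum_(v in hex_ends e) cover_dir (g v) e.2)%N.
    rewrite [RHS]big_mkcond; apply: eq_bigr => v _; case: ifP => ve.
      by apply: eq_card => t; rewrite !inE inr_k4_ends ve.
    by apply/eqP; rewrite cards_eq0; apply/eqP/setP => t; rewrite !inE inr_k4_ends ve andbF.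
  by rewrite hex_endsE big_setU1 ?big_set1 // inE.
apply/forallP/andP => [H|[/forallP Hv /forallP He] [v|e]].
- split; apply/forallP => u; first by have := H (inl u); rewrite inlE.
  by have := H (inr u); rewrite inrE.
- by rewrite inlE.
by rewrite inrE.
Qed.

(* O is the set of the edges matched inside the copy of K_4 of their W end, and *)
(* [in_dirs O v] gives the directions of the edges matched inside that of v.    *)
Definition in_dirs (O : {set E}) (v : V) : pred direction :=
  fun d => match v with inl _ => inc_edge v d \in O | inr _ => inc_edge v d \notin O end.

Lemma inc_edge_black_end (e : E) : inc_edge (black_end e) e.2 = e.
Proof. by case: e => p d; rewrite /= black_unshiftK. Qed.

Lemma black_end_inc_edge p d : black_end (inc_edge (inr p) d) = inr p :> V.
Proof. by rewrite /black_end /= black_shiftK. Qed.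

(** Once O is fixed, the conditions linking the two ends of an edge decouple into independent
    conditions at the vertices, so the sum over families factors. *)
Lemma perfect_matching_in_dirs (g : {ffun V -> {set ledge}}) (O : {set E}) :
  perfect_matching (G := silicate_torus n m) (k4_family g)
    && ([set e : E | cover_dir (g (inl e.1)) e.2 == 1%N] == O) =
  [forall v, (spokes (g v) == 1%N)
             && [forall d, cover_dir (g v) d == in_dirs O v d :> nat]].
Proof.
rewrite perfect_matching_k4_family.
apply/andP/forallP => [[/andP[/forallP Hs /forallP He] /eqP<-] v|H].
  rewrite Hs /=; apply/forallP => d; case: v => p; rewrite /in_dirs inE.
    by have := He (p, d) => /=; case: (cover_dir _ _) => [|[|?]].
  have := He (inc_edge (inr p) d); rewrite black_end_inc_edge inc_edge_dir.
  by case: (cover_dir _ _) => [|[|?]]; case: (cover_dir _ _) => [|[|?]].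
have Hc v d : cover_dir (g v) d = in_dirs O v d :> nat.
  by have /andP[_ /forallP/(_ d)/eqP] := H v.
have Hw (e : E) : cover_dir (g (inl e.1)) e.2 = (e \in O) :> nat by rewrite Hc; case: e.
split; last by apply/eqP/setP => e; rewrite inE Hw; case: (e \in O).
apply/andP; split; apply/forallP => u; first by have /andP[] := H u.
rewrite Hw Hc /in_dirs inc_edge_black_end.
by case: (u \in O).
Qed.

Lemma dimer_sum_local (R : realType) (w : edge (silicate_torus n m) -> R) (lw : ledge -> R) :
  (forall v t, w (k4_edge (v, t)) = lw t) ->
  dimer_sum w = \sum_(O : {set E}) \prod_v local_sum lw (in_dirs O v).
Proof.
move=> wE; rewrite /dimer_sum (reindex k4_family); last exact/onW_bij/k4_family_bij.
pose O_ (g : {ffun V -> {set ledge}}) := [set e : E | cover_dir (g (inl e.1)) e.2 == 1%N].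
rewrite (partition_big O_ xpredT) //=; apply: eq_bigr => O _.
under [RHS]eq_bigr do rewrite /local_sum big_mkcond.
rewrite bigA_distr_bigA big_mkcond; apply: eq_bigr => g _.
rewrite perfect_matching_in_dirs; case: ifPn => [/forallP ok|].
  rewrite big_imset => [|x y _ _]; last exact: k4_edge_inj.
  under [RHS]eq_bigr do rewrite ok.
  by rewrite pair_big_dep; apply: eq_bigr => -[v t] _; rewrite wE.
by rewrite negb_forall => /existsP[v /negPf nv]; rewrite (bigD1 v) //= nv mul0r.
Qed.

(** * Counting received edges *)

Lemma sum_in_dirs (O : {set E}) d : (\sum_v in_dirs O v d = m * n)%N.
Proof.
(* Pairs each W vertex with the B end of its edge of direction d: exactly one of the two receives
   that edge. *)
rewrite big_sumType /= [X in (_ + X)%N](reindex (black_unshift d)); last first.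
  by exists (black_shift d) => p _; rewrite ?black_shiftK ?black_unshiftK.
rewrite -big_split /=; under eq_bigr => p _.
  rewrite black_unshiftK (_ : (_ + _)%N = 1%N); last by case: (_ \in _).
  over.
by rewrite sum1_card card_prod !card_ord.
Qed.

Definition all_odd (O : {set E}) := [forall v, odd (\sum_d in_dirs O v d)].

(** A vertex receiving an odd number of its three edges receives 1, plus 2 if it receives all;
    summing over vertices, 3mn = 2mn + 2k. *)
Lemma card_full_in_dirs (O : {set E}) :
  all_odd O -> (\sum_(v : V) [forall d, in_dirs O v d] = (m * n)./2)%N.
Proof.
move=> /forallP oddO; set k := (\sum_(v : V) _)%N.
have : (\sum_(v : V) \sum_d in_dirs O v d = (m * n + m * n) + 2 * k)%N.
  have -> : (m * n + m * n = \sum_(v : V) 1)%N.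
    by rewrite sum1_card card_sum card_prod !card_ord.
  rewrite /k big_distrr -big_split; apply: eq_bigr => v _ /=.
  have := oddO v; rewrite forall_directionE big_direction.
  by case: (in_dirs O v _); case: (in_dirs O v _); case: (in_dirs O v _).
rewrite exchange_big; under eq_bigr do rewrite sum_in_dirs.
by rewrite big_direction /=; lia.
Qed.

Lemma prod_local_sum (R : comNzRingType) (lw : ledge -> R) (O : {set E}) :
  ~~ odd (m * n) ->
  \prod_v local_sum lw (in_dirs O v) =
  if all_odd O then (\sum_d lw (d, true) * lw (d, false)) ^+ (m * n)./2
    * \prod_d lw (d, false) ^+ (m * n)./2 else 0.
Proof.
move=> ev; under eq_bigr do rewrite local_sumE.
case: ifPn => [oddO|]; last first.
  by rewrite negb_forall => /existsP[v /negPf nv]; rewrite (bigD1 v) //= nv mul0r.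
under eq_bigr do rewrite (forallP oddO).
rewrite big_split prodrXr card_full_in_dirs // exchange_big /=; congr (_ * _).
(* The exponent is mn - mn/2, which is mn/2 because mn is even. *)
apply: eq_bigr => d _; rewrite prodrXr sumnB => [|v _].
  by rewrite sum_in_dirs card_full_in_dirs //; congr (_ ^+ _); lia.
by case: forallP => // ->.
Qed.

(** * The number of admissible distributions of the edges *)

Definition inc_edges (v : V) : {set E} := [set inc_edge v d | d : direction].

Definition is_white (v : V) : bool := if v is inl _ then true else false.

(** A B vertex receives its edges outside O; as it has three edges, it receives an odd number
    exactly when O contains an even number of them. *)
Lemma all_odd_parity (O : {set E}) :
  all_odd O = [forall v, odd #|O :&: inc_edges v| == is_white v].
Proof.
apply: eq_forallb => v.
have -> : #|O :&: inc_edges v| = (\sum_d (inc_edge v d \in O))%N.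
  have -> : O :&: inc_edges v = inc_edge v @: [set d | inc_edge v d \in O].
    apply/setP => e; rewrite inE; apply/andP/imsetP => [[eO /imsetP[d _ ed]]|[d]].
      by exists d; rewrite // inE -ed.
    by rewrite inE => dO ->; split=> //; apply/imsetP; exists d.
  rewrite card_imset; last exact: inc_edge_inj.
  by rewrite -sum1dep_card big_mkcond; apply: eq_bigr => d _; case: ifP.
by rewrite !big_direction; case: v => p; rewrite /in_dirs /=; do 3!case: (_ \in O).
Qed.

(** Evenness means that each edge has both ends in S or neither, so S is a union of connected
    components, and the torus is connected: crossing one edge and returning along a slash edge moves
    a W vertex one step in either coordinate. *)
Lemma even_sets_trivial (S : {set V}) : (0 < n)%N -> (0 < m)%N ->
  [forall e, ~~ odd #|[set v in S | e \in inc_edges v]|] = (S == set0) || (S == setT).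
Proof.
move=> n0 m0.
have inc_edgesE e (v : V) : (e \in inc_edges v) = (v \in hex_ends e).
  rewrite mem_hex_ends; apply/imsetP/eqP => [[d _ ->]|->]; first by rewrite inc_edge_dir.
  by exists e.2.
have cardE (e : E) : #|[set v in S | e \in inc_edges v]|
    = ((inl e.1 \in S) + (black_end e \in S))%N.
  rewrite -sum1_card (eq_bigl (fun v => (v \in hex_ends e) && (v \in S))); last first.
    by move=> v; rewrite inE inc_edgesE andbC.
  by rewrite big_mkcondr hex_endsE big_setU1 ?big_set1 ?inE //=; do 2!case: ifP.
apply/forallP/orP => [H|[]/eqP SE e]; last first.
- by rewrite cardE SE !inE.
- by rewrite cardE SE !inE.
have {H}H (p : P) d : (inl p \in S) = (inr (black_unshift d p) \in S).
  by have := H (p, d); rewrite cardE oddD !oddb negb_add => /eqP.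
have H0 p d : (inl p \in S) = (inl (black_unshift d p) \in S).
  by rewrite (H p d) (H _ Slash).
pose p0 : P := (Ordinal m0, Ordinal n0).
have Hi k (hk : (k < m)%N) j : (inl (Ordinal hk, j) \in S) = (inl (Ordinal m0, j) \in S).
  elim: k hk => [|k IH] hk; first by congr (inl (_, _) \in S); apply: val_inj.
  rewrite (H0 _ Vertical) -(IH (ltnW hk)); congr (inl (_, _) \in S); apply: val_inj.
  by rewrite /= modnDr modn_small // ltnW.
have Hj k (hk : (k < n)%N) i : (inl (i, Ordinal hk) \in S) = (inl (i, Ordinal n0) \in S).
  elim: k hk => [|k IH] hk; first by congr (inl (_, _) \in S); apply: val_inj.
  rewrite (H0 _ Backslash) -(IH (ltnW hk)); congr (inl (_, _) \in S); apply: val_inj.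
  by rewrite /= modnDr modn_small // ltnW.
have Hw p : (inl p \in S) = (inl p0 \in S) by case: p => -[i hi] [j hj]; rewrite Hi Hj.
have Hv (v : V) : (v \in S) = (inl p0 \in S) by case: v => p; rewrite -?(H p Slash) Hw.
case S0: (inl p0 \in S); [right|left]; apply/eqP/setP => v; by rewrite Hv S0 !inE.
Qed.

Lemma card_all_odd (R : realType) : (0 < n)%N -> (0 < m)%N -> ~~ odd (m * n) ->
  #|[set O | all_odd O]|%:R = 2 ^+ (m * n + 1) :> R.
Proof.
move=> n0 m0 ev.
have := card_parity_sets R inc_edges is_white.
rewrite (eq_bigl _ _ (fun S => even_sets_trivial S n0 m0)).
rewrite (bigD1 set0) ?eqxx //= (big_pred1 setT) => [|S]; last first.
  rewrite !inE; have [->|] := eqVneq S set0; last by rewrite andbT.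
  rewrite andbF; apply/esym/eqP => /setP/(_ (inl (Ordinal m0, Ordinal n0))).
  by rewrite !inE.
have -> : [set O | all_odd O] = [set O | [forall v, odd #|O :&: inc_edges v| == is_white v]].
  by apply/setP => O; rewrite !inE all_odd_parity.
have -> : #|[set v in set0 | is_white v]| = 0%N.
  by apply/eqP; rewrite cards_eq0; apply/eqP/setP => v; rewrite !inE.
have -> : #|[set v in [set: V] | is_white v]| = (m * n)%N.
  rewrite -sum1dep_card big_sumType /= addnC big_pred0 => [|p]; last by rewrite andbF.
  rewrite (eq_bigl xpredT) => [|p]; last by rewrite inE.
  by rewrite sum1_card card_prod !card_ord.
have -> : #|V| = (m * n + m * n)%N by rewrite card_sum card_prod !card_ord.
have -> : #|E| = (m * n + m * n + m * n)%N.
  rewrite !card_prod !card_ord; have -> : #|{: direction}| = 3.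
    by rewrite -sum1_card big_direction.
  lia.
(* As mn is even, the full set has sign +1 like the empty one, and the count times 2^(2mn) is 2 *
   2^(3mn). *)
rewrite -[(-1) ^+ (m * n)]signr_odd (negPf ev) expr0 mul1r => H.
apply: (mulfI (x := 2 ^+ (m * n + m * n))); first by rewrite expf_neq0 ?pnatr_eq0.
by rewrite H -mulr2n -[LHS]mulr_natr -exprSr -exprD addnA addn1.
Qed.

End Silicate.

Theorem theorem3p1 (R : realType) (n m : nat) (a b c x y z : R)
    (hn : (0 < n)%N) (hm : (0 < m)%N) (hmn : ~~ odd (m * n)%N)
    (ha : 0 < a) (hb : 0 < b) (hc : 0 < c)
    (hx : 0 < x) (hy : 0 < y) (hz : 0 < z) :
  dimer_sum (G := silicate_torus n m) (silicate_weight a b c x y z) =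
  2 ^+ (m * n + 1)%N * (x * y * z) ^+ (m * n)./2
    * (a * x + b * y + c * z) ^+ (m * n)./2.
Proof.
rewrite (dimer_sum_local (lw := ledge_weight a b c x y z)); last first.
  by move=> v t; rewrite silicate_weight_k4.
under eq_bigr do rewrite prod_local_sum //.
(* All nonzero terms are equal, so the sum is their number times the common weight. *)
rewrite -big_mkcond (eq_bigl (mem [set O | all_odd O])) => [|O]; last by rewrite /= inE.
rewrite sumr_const -[LHS]mulr_natl card_all_odd //.
rewrite !big_direction /ledge_weight /= -!exprMn -!mulrA -!exprMn.
congr (_ * _ ^+ _); ring.
Qed.
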